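(* Let $\mu$ be a permuton, $k\in\mathbb{N}^*$, and $\sigma_n\sim\mathrm{Sample}_n(\mu)$ for each $n\in\mathbb{N}^*$. Then for any $\alpha\in\big(\widetilde{\mathrm{LIS}}_k(\mu),1\big]$: $$\frac1n\log\mathbf{P}\big(\mathrm{LIS}_k(\sigma_n)\ge\alpha n\big)\xrightarrow[n\to\infty]{}-\Lambda^*_{\widetilde{\mathrm{LIS}}_k(\mu)}(\alpha).$$
   Context: $\mathbb{N}^*=\{1,2,\dots\}$. A permuton is a Borel probability measure on $[0,1]^2$ with both marginals uniform on $[0,1]$. Given points $Z_1,\dots,Z_n\in[0,1]^2$ with distinct $x$-coordinates and distinct $y$-coordinates, $\mathrm{Perm}(Z_1,\dots,Z_n)$ is the permutation $\sigma$ of $\{1,\dots,n\}$ with $\sigma(i)=j$ whenever the point with $i$-th lowest $x$-coordinate has $j$-th lowest $y$-coordinate. $\mathrm{Sample}_n(\mu)$ is the law of $\mathrm{Perm}(Z_1,\dots,Z_n)$ for $Z_1,\dots,Z_n$ i.i.d. with law $\mu$ (a.s. well defined). For a permutation $\sigma$ of size $n$, an increasing subsequence is a set of indices $\{i_1<\dots<i_\ell\}$ with $\sigma(i_1)<\dots<\sigma(i_\ell)$; $\mathrm{LIS}_k(\sigma):=\max|I_1\cup\dots\cup I_k|$ over families of $k$ increasing subsequences. A subset $A\subset[0,1]^2$ is nondecreasing if $(x_2-x_1)(y_2-y_1)\ge 0$ for all $(x_1,y_1),(x_2,y_2)\in A$, and $k$-nondecreasing if it is a union of $k$ nondecreasing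 subsets. $\widetilde{\mathrm{LIS}}_k(\mu):=\sup_A \mu(A)$ over closed $k$-nondecreasing $A\subset[0,1]^2$. For $p,q\in[0,1]$, $\Lambda_p^*(q):=q\log\frac qp+(1-q)\log\frac{1-q}{1-p}\in[0,+\infty]$, with the usual conventions ($0\log\frac{0}{\cdot}=0$, and $q\log\frac q0=+\infty$ for $q>0$). Also $\log 0=-\infty$. *)

(* Defs.v *)
From HB Require Import structures.
From mathcomp Require Import all_boot all_order all_algebra all_fingroup.
From mathcomp Require Import all_classical all_reals all_analysis.

Set Implicit Arguments.
Unset Strict Implicit.
Unset Printing Implicit Defensive.

Import Order.TTheory GRing.Theory Num.Theory.
Import numFieldNormedType.Exports.

Local Open Scope classical_set_scope.
Local Open Scope ring_scope.

Section Permutons.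
Context {R : realType}.

Local Notation plane := (measurableTypeR R * measurableTypeR R)%type.

Definition unit_square : set (R * R) := `[0, 1] `*` `[0, 1].

(** Borel probability measures on [0,1]^2 are encoded as probability measures
    on the plane that give full mass to the square. *)
Definition is_permuton (mu : probability plane R) : Prop :=
  [/\ mu unit_square = 1%E,
      forall A : set (measurableTypeR R), measurable A ->
        mu (fst @^-1` A) = uniform_prob (@ltr01 R) A
    & forall A : set (measurableTypeR R), measurable A ->
        mu (snd @^-1` A) = uniform_prob (@ltr01 R) A].

(** Number of entries of [u] that are smaller than [u i]. *)
Definition rank n (u : 'I_n -> R) (i : 'I_n) : nat :=
  #|[set j : 'I_n | u j < u i]|%SET.

(** Ranks and ['S_n] are 0-based.  If all x-coordinates are distinct and all
    y-coordinates are distinct, exactly one [s] satisfies the condition;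
    the default value 1 only matters in the presence of ties. *)
Definition perm_of_points n (z : 'I_n -> R * R) : 'S_n :=
  odflt 1%g [pick s : 'S_n | [forall i : 'I_n, forall a : 'I_n,
    (val a == rank (fst \o z) i) ==> (val (s a) == rank (snd \o z) i)]].

Definition mutually_independent d (T : measurableType d)
    (Q : probability T R) n (Z : 'I_n -> {mfun T >-> plane}) : Prop :=
  forall (J : {set 'I_n}) (A : 'I_n -> set plane),
    (forall i, measurable (A i)) ->
    Q (\bigcap_(i in [set` J]) (Z i @^-1` A i))
    = (\prod_(i in J) Q (Z i @^-1` A i))%E.

Definition iid d (T : measurableType d) (Q : probability T R)
    (mu : probability plane R) n (Z : 'I_n -> {mfun T >-> plane}) : Prop :=
  mutually_independent Q Z /\
  forall i (A : set plane), measurable A -> Q (Z i @^-1` A) = mu A.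

(** The random permutation [sigma], defined on the probability space [(T, P)],
    has law Sample_n(mu).  The points [Z] may live on another space. *)
Definition has_law_Sample (mu : probability plane R) n d
    (T : measurableType d) (P : probability T R) (sigma : T -> 'S_n) : Prop :=
  (forall s, measurable (sigma @^-1` [set s])) /\
  exists d' (T' : measurableType d') (Q : probability T' R)
         (Z : 'I_n -> {mfun T' >-> plane}),
    iid Q mu Z /\
    forall s, P (sigma @^-1` [set s])
              = Q [set w | perm_of_points (fun i => Z i w) = s].

Definition increasing_subseq n (s : 'S_n) (I : {set 'I_n}) : bool :=
  [forall i in I, forall j in I, (i < j)%N ==> (s i < s j)%N].

Definition LIS (k : nat) n (s : 'S_n) : nat :=
  \max_(F : {ffun 'I_k -> {set 'I_n}}
        | [forall j, increasing_subseq s (F j)]) #|(\bigcup_j F j)%SET|.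

Definition nondecreasing_set (A : set (R * R)) : Prop :=
  forall a b, A a -> A b -> 0 <= (b.1 - a.1) * (b.2 - a.2).

Definition k_nondecreasing (k : nat) (A : set (R * R)) : Prop :=
  exists B : 'I_k -> set (R * R),
    (forall j, nondecreasing_set (B j)) /\ A = \bigcup_j B j.

(** The supremum lies in [0, 1] (the empty set is admissible), so [fine] loses
    nothing. *)
Definition LIS_tilde (k : nat) (mu : probability plane R) : R :=
  fine (ereal_sup [set mu A | A in
    [set A : set (R * R) |
      [/\ closed A, A `<=` unit_square & k_nondecreasing k A]]]).

Definition xlogdiv (q p : R) : \bar R :=
  if q == 0 then 0%E else if p == 0 then +oo%E else (q * ln (q / p))%:E.

Definition Lambda_star (p q : R) : \bar R :=
  (xlogdiv q p + xlogdiv (1 - q) (1 - p))%E.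

End Permutons.

(* Main.v *)
Require Import Defs.
From mathcomp Require Import all_boot all_order all_algebra all_fingroup.
From mathcomp Require Import all_classical all_reals all_analysis.
From mathcomp Require Import measurable_realfun.
From mathcomp Require Import zify ring lra.
Import Order.TTheory GRing.Theory Num.Theory.
Import numFieldNormedType.Exports.
Local Open Scope classical_set_scope.
Local Open Scope ring_scope.

(** Both bounds compare [LIS_k] with the number of sample points in a set [D],
    which is binomial with success probability [mu D].

    Lower bound: if [D] is closed and k-nondecreasing then almost surely [LIS_k]
    is at least this number, and [mu D] can be taken close to the supremum
    [LIS_tilde k mu].

    Upper bound: cut the square into cells of mesh [1 / M].  The cells met by
    [k] increasing subsequences form [k] chains up to an error [1 / M], and there
    are finitely many such families of cells, independently of [n].  By a union
    bound and Chernoff's inequality it is enough that the largest mass of such a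
    family tends to [LIS_tilde k mu] as [M] grows, which holds by compactness. *)

(** Every estimate is proved at a rate strictly on one side of the limit. This spare room absorbs
    what does not count on the exponential scale: the factor [n.+1] of the binomial lower bound and
    the number of families of cells. The increasing subsequences depend on the sample, so a union
    bound over them would have a number of terms growing with [n]. Rounding to a mesh that is fixed
    before [n] avoids this, but rounded chains are only approximately nondecreasing. Compactness
    bounds their mass by a value slightly above [LIS_tilde k mu], hence the Chernoff bound has to
    hold uniformly for success probabilities up to such a value. Attainment of the supremum is not
    established; the lower bound uses nearly optimal sets and the continuity of the rate in the
    success probability. *)

Set Implicit Arguments.
Unset Strict Implicit.

(** * Ranks, and [LIS] read off points in general position *)

Section Ranks.
Context {R : realType}.

Section OneCoordinate.
Variables (n : nat) (u : 'I_n -> R).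

Lemma ltn_rank i j : u i < u j -> (rank u i < rank u j)%N.
Proof.
move=> uij; apply: proper_card; apply/properP; split.
  by apply/fintype.subsetP => l; rewrite !inE => /lt_trans; exact.
by exists i; rewrite !inE ?ltxx.
Qed.

Lemma rank_ltn i : (rank u i < n)%N.
Proof.
rewrite -[ltnRHS]card_ord -cardsT; apply: proper_card.
by apply/properP; split; [exact: finset.subsetT|exists i; rewrite !inE ?ltxx].
Qed.

Hypothesis u_inj : injective u.

Lemma ltn_rankE i j : (rank u i < rank u j)%N = (u i < u j).
Proof.
apply/idP/idP; last exact: ltn_rank.
apply: contraTT; rewrite -leNgt -leqNgt le_eqVlt => /predU1P[/u_inj ->//|].
by move=> /ltn_rank /ltnW.
Qed.

Lemma rank_ord_inj : injective (fun i => Ordinal (rank_ltn i)).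
Proof.
move=> i j [] rij; apply: u_inj; apply/eqP; rewrite eq_le !leNgt.
by rewrite -!ltn_rankE rij ltnn.
Qed.

Definition rank_perm : 'S_n := perm rank_ord_inj.

Lemma val_rank_perm i : rank_perm i = rank u i :> nat.
Proof. by rewrite permE. Qed.

End OneCoordinate.

Section Points.
Variables (n : nat) (z : 'I_n -> R * R).
Hypotheses (z1_inj : injective (fst \o z)) (z2_inj : injective (snd \o z)).

Lemma perm_of_points_rank i :
  perm_of_points z (rank_perm z1_inj i) = rank_perm z2_inj i.
Proof.
rewrite /perm_of_points; case: pickP => [s /= /forallP sP|/=].
  apply: val_inj => /=; rewrite [RHS]val_rank_perm.
  have /forallP /(_ (rank_perm z1_inj i)) := sP i.
  by rewrite val_rank_perm eqxx => /eqP.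
(* This permutation meets the condition, so [pick] cannot fail and the default value is never
   reached. *)
move=> /(_ ((rank_perm z1_inj)^-1 * rank_perm z2_inj)%g) /negP[].
apply/forallP => j; apply/forallP => a; apply/implyP.
rewrite -(val_rank_perm z1_inj) => /eqP /val_inj ->.
by rewrite permM permK val_rank_perm.
Qed.

Definition increasing_points (I : {set 'I_n}) :=
  forall i j, i \in I -> j \in I -> (z i).1 < (z j).1 -> (z i).2 < (z j).2.

(** Points are labelled in the order of drawing, positions of the permutation by rank of the
    x-coordinate; [rank_perm z1_inj] translates the first labelling into the second. *)
Lemma increasing_subseq_rank (I : {set 'I_n}) :
  increasing_subseq (perm_of_points z) (rank_perm z1_inj @: I)%SET <->
  increasing_points I.
Proof.
split.
  move=> /forall_inP incI i j iI jI zij.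
  have /forall_inP := incI _ (imset_f (rank_perm z1_inj) iI).
  move=> /(_ _ (imset_f _ jI)) /implyP.
  rewrite !perm_of_points_rank !val_rank_perm !ltn_rankE//; exact.
move=> incI; apply/forall_inP => _ /imsetP[i iI ->].
apply/forall_inP => _ /imsetP[j jI ->]; apply/implyP.
by rewrite !perm_of_points_rank !val_rank_perm !ltn_rankE//; exact: incI.
Qed.

Lemma LIS_ge_points k (G : 'I_k -> {set 'I_n}) :
  (forall j, increasing_points (G j)) ->
  (#|(\bigcup_j G j)%SET| <= LIS k (perm_of_points z))%N.
Proof.
move=> incG; pose F := [ffun j => (rank_perm z1_inj @: G j)%SET].
have -> : #|(\bigcup_j G j)%SET| = #|(\bigcup_j F j)%SET|.
  rewrite -(card_imset _ (@perm_inj _ (rank_perm z1_inj))).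
  rewrite (big_morph _ (@imsetU _ _ (rank_perm z1_inj)) (imset0 _)).
  by under [in RHS]eq_bigr do rewrite ffunE.
apply: (@leq_bigmax_cond _ _ (fun F : {ffun 'I_k -> {set 'I_n}} =>
  #|(\bigcup_j F j)%SET|)).
by apply/forallP => j; rewrite ffunE; exact/increasing_subseq_rank.
Qed.

Lemma LIS_points k : exists2 G : 'I_k -> {set 'I_n},
  (forall j, increasing_points (G j)) &
  LIS k (perm_of_points z) = #|(\bigcup_j G j)%SET|.
Proof.
(* The empty family makes the maximum range over a nonempty collection, so that it is attained. *)
pose F0 : {ffun 'I_k -> {set 'I_n}} := [ffun=> finset.set0].
have F0P : [forall j, increasing_subseq (perm_of_points z) (F0 j)].
  by apply/forallP => j; apply/forall_inP => i; rewrite ffunE finset.inE.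
have [|F /forallP incF LISE] := @eq_bigmax_cond _
  [pred F : {ffun _} | [forall j, increasing_subseq (perm_of_points z) (F j)]]
  (fun F : {ffun 'I_k -> {set 'I_n}} => #|(\bigcup_j F j)%SET|).
  by apply/card_gt0P; exists F0.
have pimK (I : {set 'I_n}) :
    (rank_perm z1_inj @: (rank_perm z1_inj @^-1: I))%SET = I.
  apply/finset.setP => i; apply/imsetP/idP => [[j]|iI].
    by rewrite finset.inE => /[swap] ->.
  by exists ((rank_perm z1_inj)^-1%g i); rewrite ?finset.inE permKV.
exists (fun j => rank_perm z1_inj @^-1: F j)%SET.
  by move=> j; apply/increasing_subseq_rank; rewrite pimK.
rewrite /LIS LISE -[RHS](card_imset _ (@perm_inj _ (rank_perm z1_inj))).
rewrite (big_morph _ (@imsetU _ _ (rank_perm z1_inj)) (imset0 _)).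
by congr #|pred_of_set _|; apply: eq_bigr => j _ /=; rewrite pimK.
Qed.

End Points.
End Ranks.

(** * The largest term of a binomial expansion *)

Section BinomialTail.

(* The summands [i |-> 'C(n, i) * j ^ i * (n - j) ^ (n - i)] of [n ^ n] are
   largest at the mode [i = j]. *)
Lemma binomial_term_incr n j i : (i < j <= n)%N ->
  ('C(n, i) * (j ^ i * (n - j) ^ (n - i)) <=
   'C(n, i.+1) * (j ^ i.+1 * (n - j) ^ (n - i.+1)))%N.
Proof.
move=> /andP[ij jn].
(* The factor [i.+1] turns one binomial coefficient into the other; what remains is
   [i.+1 * (n - j) <= (n - i) * j]. *)
rewrite -(@leq_pmul2l i.+1)// [leqRHS]mulnA mul_bin_left.
have Eni : (n - i = (n - i.+1).+1)%N by lia.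
rewrite expnS [in leqLHS]Eni expnS.
have -> : ((n - i) * 'C(n, i) * (j * j ^ i * (n - j) ^ (n - i.+1)) =
  ((n - i) * j) * ('C(n, i) * (j ^ i * (n - j) ^ (n - i.+1))))%N by ring.
have -> : (i.+1 * ('C(n, i) * (j ^ i * ((n - j) * (n - j) ^ (n - i.+1)))) =
  (i.+1 * (n - j)) * ('C(n, i) * (j ^ i * (n - j) ^ (n - i.+1))))%N by ring.
by apply: leq_mul => //; nia.
Qed.

Lemma binomial_term_decr n j i : (j <= i < n)%N ->
  ('C(n, i.+1) * (j ^ i.+1 * (n - j) ^ (n - i.+1)) <=
   'C(n, i) * (j ^ i * (n - j) ^ (n - i)))%N.
Proof.
move=> /andP[ji ni].
rewrite -(@leq_pmul2l i.+1)// [leqLHS]mulnA mul_bin_left.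
have Eni : (n - i = (n - i.+1).+1)%N by lia.
rewrite [in leqRHS]Eni !expnS.
have -> : ((n - i) * 'C(n, i) * (j * j ^ i * (n - j) ^ (n - i.+1)) =
  ((n - i) * j) * ('C(n, i) * (j ^ i * (n - j) ^ (n - i.+1))))%N by ring.
have -> : (i.+1 * ('C(n, i) * (j ^ i * ((n - j) * (n - j) ^ (n - i.+1)))) =
  (i.+1 * (n - j)) * ('C(n, i) * (j ^ i * (n - j) ^ (n - i.+1))))%N by ring.
by apply: leq_mul => //; nia.
Qed.

Lemma binomial_mode n j i : (j <= n)%N -> (i <= n)%N ->
  ('C(n, i) * (j ^ i * (n - j) ^ (n - i)) <=
   'C(n, j) * (j ^ j * (n - j) ^ (n - j)))%N.
Proof.
move=> jn; have [ij _|ij] := leqP i j.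
  rewrite -(subKn ij); elim: (j - i)%N (leq_subr i j) => [|m IH] mj.
    by rewrite subn0.
  apply: leq_trans (IH (ltnW mj)).
  have -> : (j - m = (j - m.+1).+1)%N by lia.
  by apply: binomial_term_incr; lia.
elim: i ij => // i IH ij ni; have [ji|] := leqP i j.
  by have -> : j = i by [lia]; apply: binomial_term_decr; lia.
move=> /IH /(_ (ltnW ni)); apply: leq_trans.
by apply: binomial_term_decr; lia.
Qed.

(** The [n.+1] terms of the expansion of [((n - j) + j) ^ n] are at most the modal one. This takes
    the place of Stirling's formula. *)
Lemma binomial_ge n j : (j <= n)%N ->
  (n ^ n <= n.+1 * ('C(n, j) * (j ^ j * (n - j) ^ (n - j))))%N.
Proof.
move=> jn; rewrite -[X in (X ^ _ <= _)%N](subnK jn) expnDn.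
set X := (X in (_ <= _ * X)%N).
have -> : (n.+1 * X = \sum_(i < n.+1) X)%N by rewrite sum_nat_const card_ord.
apply: leq_sum => i _; rewrite [(_ ^ _ * _)%N]mulnC.
by apply: binomial_mode; rewrite // -ltnS.
Qed.

End BinomialTail.

(** * Large deviations of the binomial distribution *)

Section BinomialLargeDeviations.
Context {R : realType}.
Implicit Types (p q r a t c : R) (n j : nat).

Lemma near_mul_expRN_le1 c r : 0 < r ->
  \forall n \near \oo, c * expR (- (r * n%:R)) <= 1.
Proof.
move=> r0; near=> n.
rewrite expRN ler_pdivrMr ?expR_gt0// mul1r.
apply: le_trans (expR_ge1Dx _); apply: ler_wpDl => //.
rewrite -ler_pdivrMl// mulrC.
near: n; exact: nbhs_infty_ger.
Unshelve. all: by end_near. Qed.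

Lemma near_natS_expRN_le1 r : 0 < r ->
  \forall n \near \oo, n.+1%:R * expR (- (r * n%:R)) <= 1.
Proof.
move=> r0; near=> n.
rewrite expRN ler_pdivrMr ?expR_gt0// mul1r.
(* Squaring [1 + x <= expR x] at half the exponent gives quadratic growth, whose term
   [r ^+ 2 * n ^+ 2 / 4] dominates [n] once [n] is at least [4 / r ^+ 2]. *)
have -> : r * n%:R = (r / 2 * n%:R) * 2%:R by field.
rewrite expRM_natr; have := expR_ge1Dx (r / 2 * n%:R).
set x := expR _ => hx.
have n0 : 0 <= n%:R :> R by [].
have rn : 4 / r ^+ 2 <= n%:R by near: n; exact: nbhs_infty_ger.
have rn' : 4 <= r ^+ 2 * n%:R by rewrite mulrC -ler_pdivrMr// exprn_gt0.
have h1 : 0 <= 1 + r / 2 * n%:R by nra.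
have : (1 + r / 2 * n%:R) ^+ 2 <= x ^+ 2 by rewrite lerXn2r// nnegrE; lra.
apply: le_trans; rewrite -natr1; nra.
Unshelve. all: by end_near. Qed.

(** The sum runs over the set [J] of successes instead of their number, to match the partition of
    the sample space by the set of indices whose points fall in a given region. *)
Definition binomial_tail n p a : R :=
  \sum_(J : {set 'I_n} | a * n%:R <= #|J|%:R) p ^+ #|J| * (1 - p) ^+ (n - #|J|).

Lemma prod_bernoulli_weight n p q (J : {set 'I_n}) :
  \prod_i (if i \in J then p else q) = p ^+ #|J| * q ^+ (n - #|J|).
Proof.
rewrite (bigID (mem J))/=; congr (_ * _).
  under eq_bigr => i -> do [].
  by rewrite prodr_const.
under eq_bigr => i /negbTE -> do [].
rewrite prodr_const; congr (_ ^+ _).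
by apply/eqP; rewrite -(eqn_add2l #|J|) subnKC ?cardC ?card_ord//
  -[leqRHS]card_ord max_card.
Qed.

Lemma sum_bernoulli_weights n p q :
  \sum_(J : {set 'I_n}) p ^+ #|J| * q ^+ (n - #|J|) = (p + q) ^+ n.
Proof.
rewrite -[in RHS](card_ord n) -prodr_const.
rewrite (bigA_distr (1 : R) +%R (fun=> p) (fun=> q)).
by apply: eq_bigr => J _; rewrite prod_bernoulli_weight.
Qed.

(** Markov's inequality for the exponential moment, which is nondecreasing in the success
    probability since [t] is nonnegative; hence one bound, at [p'], serves every smaller [p]. *)
Lemma binomial_tail_chernoff n p p' a t :
  0 <= t -> 0 <= p -> p <= p' -> p' <= 1 ->
  binomial_tail n p a <=
  expR (- (t * a * n%:R)) * (expR t * p' + (1 - p')) ^+ n.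
Proof.
move=> t0 p0 pp' p'1; have p1 := le_trans pp' p'1.
have et1 : 1 <= expR t by have := expR_ge1Dx t; lra.
have w0 : 0 <= 1 - p by rewrite subr_ge0.
apply: (@le_trans _ _ (expR (- (t * a * n%:R)) * (expR t * p + (1 - p)) ^+ n)).
  rewrite -sum_bernoulli_weights mulr_sumr /binomial_tail big_mkcond/=.
  apply: ler_sum => J _; case: ifPn => [aJ|_]; last first.
    by rewrite !mulr_ge0 ?expR_ge0 ?exprn_ge0 ?mulr_ge0 ?expR_ge0.
  rewrite mulrA ler_wpM2r ?exprn_ge0// exprMn mulrA -expRM_natr -expRD.
  rewrite ler_peMl ?exprn_ge0//.
  apply: le_trans (expR_ge1Dx _); rewrite lerDl -mulrA -mulrN -mulrDr.
  by rewrite mulr_ge0// addrC subr_ge0.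
rewrite ler_wpM2l ?expR_ge0// lerXn2r ?nnegrE//; [nra|nra|nra].
Qed.

Lemma binomial_tail_ge n p a j : 0 <= p <= 1 -> (j <= n)%N ->
  a * n%:R <= j%:R ->
  'C(n, j)%:R * (p ^+ j * (1 - p) ^+ (n - j)) <= binomial_tail n p a.
Proof.
move=> /andP[p0 p1] jn aj; have w0 : 0 <= 1 - p by rewrite subr_ge0.
rewrite /binomial_tail (bigID (fun J : {set 'I_n} => #|J| == j))/=.
apply: ler_wpDr.
  by apply: sumr_ge0 => J _; rewrite mulr_ge0 ?exprn_ge0.
rewrite (eq_bigl (mem [set J : {set 'I_n} | #|J| == j]%SET)); last first.
  move=> J; rewrite !inE; case: eqP => [->|_]; last by rewrite andbF.
  by rewrite aj.
rewrite (eq_bigr (fun=> p ^+ j * (1 - p) ^+ (n - j))); last first.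
  by move=> J; rewrite !inE => /eqP ->.
by rewrite sumr_const card_draws card_ord mulr_natl.
Qed.

Definition relative_entropy p q : R :=
  q * ln (q / p) + (1 - q) * ln ((1 - q) / (1 - p)).

Lemma Lambda_star0 a : 0 < a -> Lambda_star 0 a = +oo%E.
Proof.
move=> a0; rewrite /Lambda_star /xlogdiv (gt_eqF a0) eqxx subr0.
by case: ifP => // _; rewrite oner_eq0.
Qed.

Lemma Lambda_starE p a : 0 < p < 1 -> 0 < a ->
  Lambda_star p a = (relative_entropy p a)%:E.
Proof.
move=> /andP[p0 p1] a0; rewrite /Lambda_star /xlogdiv /relative_entropy.
have q0 : 1 - p != 0 by rewrite subr_eq0 gt_eqF.
rewrite (gt_eqF a0) (gt_eqF p0) (negbTE q0).
by case: eqP => [->|_]; rewrite ?mul0r ?addr0 ?adde0// EFinD.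
Qed.

Lemma continuous_relative_entropy p q : 0 < p < 1 -> 0 < q < 1 ->
  {for q, continuous (relative_entropy p)}.
Proof.
move=> /andP[p0 p1] /andP[q0 q1]; apply: continuousD; apply: continuousM.
- exact: cvg_id.
- apply: (@continuous_comp _ _ _ (fun q => q / p) (@ln R)).
    by apply: continuousM; [exact: cvg_id|exact: cst_continuous].
  by apply: continuous_ln; rewrite divr_gt0.
- by apply: continuousB; [exact: cst_continuous|exact: cvg_id].
- apply: (@continuous_comp _ _ _ (fun q => (1 - q) / (1 - p)) (@ln R)).
    apply: continuousM; last exact: cst_continuous.
    by apply: continuousB; [exact: cst_continuous|exact: cvg_id].
  by apply: continuous_ln; rewrite divr_gt0// subr_gt0.
Qed.

Lemma continuous_relative_entropyl p q : 0 < p < 1 -> 0 < q <= 1 ->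
  {for p, continuous (relative_entropy ^~ q)}.
Proof.
(* At [q = 1] the second logarithm is taken at [0], where [continuous_ln] does not apply; its
   coefficient vanishes, so the term is removed beforehand. *)
move=> /andP[p0 p1] /andP[q0]; rewrite le_eqVlt => /predU1P[->|q1].
  have -> : relative_entropy ^~ 1 = fun p => 1 * ln (1 / p).
    by apply/funext => x; rewrite /relative_entropy subrr !mul0r addr0.
  apply: continuousM; first exact: cst_continuous.
  apply: (@continuous_comp _ _ _ (fun p => 1 / p) (@ln R)).
    apply: continuousM; first exact: cst_continuous.
    by apply: continuousV; [rewrite gt_eqF|exact: cvg_id].
  by apply: continuous_ln; rewrite divr_gt0.
apply: continuousD; apply: continuousM; try exact: cst_continuous.
- apply: (@continuous_comp _ _ _ (fun p => q / p) (@ln R)).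
    apply: continuousM; first exact: cst_continuous.
    by apply: continuousV; [rewrite gt_eqF|exact: cvg_id].
  by apply: continuous_ln; rewrite divr_gt0.
- apply: (@continuous_comp _ _ _ (fun p => (1 - q) / (1 - p)) (@ln R)).
    apply: continuousM; first exact: cst_continuous.
    apply: continuousV; first by rewrite subr_eq0 gt_eqF.
    by apply: continuousB; [exact: cst_continuous|exact: cvg_id].
  by apply: continuous_ln; rewrite divr_gt0// subr_gt0.
Qed.

(** The left side equals [(p * n / j) ^ j * ((1 - p) * n / (n - j)) ^ (n - j)], so this is
    [binomial_ge] rescaled. *)
Lemma binomial_weight_ge n j p : 0 < p < 1 -> (0 < j < n)%N ->
  expR (- (relative_entropy p (j%:R / n%:R) * n%:R)) <=
  n.+1%:R * ('C(n, j)%:R * (p ^+ j * (1 - p) ^+ (n - j))).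
Proof.
move=> /andP[p0 p1] /andP[j0 jn].
have n0 : 0 < n%:R :> R by rewrite ltr0n (ltn_trans j0).
have jR0 : 0 < j%:R :> R by rewrite ltr0n.
have nj0 : 0 < (n - j)%:R :> R by rewrite ltr0n subn_gt0.
have q0 : 0 < 1 - p by rewrite subr_gt0.
have -> : - (relative_entropy p (j%:R / n%:R) * n%:R) =
    ln (p * n%:R / j%:R) * j%:R + ln ((1 - p) * n%:R / (n - j)%:R) * (n - j)%:R.
  have -> : p * n%:R / j%:R = (j%:R / n%:R / p)^-1.
    by field; rewrite !gt_eqF.
  have -> : (1 - p) * n%:R / (n - j)%:R = ((1 - j%:R / n%:R) / (1 - p))^-1.
    by rewrite natrB 1?ltnW//; field; rewrite -natrB 1?ltnW// !gt_eqF.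
  have e1 : 0 < 1 - j%:R / n%:R :> R.
    by rewrite subr_gt0 ltr_pdivrMr// mul1r ltr_nat.
  rewrite !lnV ?posrE ?divr_gt0// natrB 1?ltnW// /relative_entropy.
  by field; rewrite gt_eqF.
rewrite expRD !expRM_natr !lnK ?posrE ?divr_gt0 ?mulr_gt0//.
rewrite !expr_div_n !exprMn.
have := binomial_ge (ltnW jn); rewrite -(ler_nat R) !natrM !natrX => nn.
have -> : p ^+ j * n%:R ^+ j / j%:R ^+ j *
    ((1 - p) ^+ (n - j) * n%:R ^+ (n - j) / (n - j)%:R ^+ (n - j)) =
    n%:R ^+ n * (p ^+ j * (1 - p) ^+ (n - j)) /
    (j%:R ^+ j * (n - j)%:R ^+ (n - j)).
  have -> : n%:R ^+ n = n%:R ^+ j * n%:R ^+ (n - j) :> R.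
    by rewrite -exprD subnKC// ltnW.
  by rewrite invfM; ring.
rewrite ler_pdivrMr ?mulr_gt0 ?exprn_gt0//.
rewrite [leRHS](_ : _ = n.+1%:R * ('C(n, j)%:R *
  (j%:R ^+ j * (n - j)%:R ^+ (n - j))) * (p ^+ j * (1 - p) ^+ (n - j))).
  by rewrite ler_wpM2r// mulr_ge0// exprn_ge0 ?ltW.
by move: (p ^+ j) ((1 - p) ^+ (n - j)) => x y; ring.
Qed.

Lemma binomial_tail_lower_bound p a r : 0 < p < 1 -> 0 < a <= 1 ->
  relative_entropy p a < r ->
  \forall n \near \oo, expR (- (r * n%:R)) <= binomial_tail n p a.
Proof.
move=> p01 /andP[a0 a1] Hr; have /andP[p0 p1] := p01.
(* For [a = 1] all trials succeed, so [j = n], a case outside [binomial_weight_ge]; the tail is at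
   least [p ^+ n]. *)
move: a1; rewrite le_eqVlt => /predU1P[a1|a1].
  move: Hr; rewrite a1 /relative_entropy subrr mul0r addr0 !mul1r => Hr.
  near=> n.
  have := @binomial_tail_ge n p 1 n.
  rewrite (ltW p0) (ltW p1) leqnn mul1r lexx subnn expr0 mulr1 binn mul1r.
  move=> /(_ isT isT isT).
  apply: le_trans; rewrite -[X in _ <= X ^+ _](lnK p0) -expRM_natr ler_expR.
  by rewrite -mulNr ler_wpM2r// lerNl -lnV// ltW.
(* One half of the gap pays for replacing [a] by [j n / n], the other for the factor [n.+1]. *)
pose d := (r - relative_entropy p a) / 2.
have d0 : 0 < d by rewrite divr_gt0// subr_gt0.
pose j n := (Num.trunc (a * n%:R)).+1.
have jP n : a * n%:R <= (j n)%:R <= a * n%:R + 1.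
  have /truncn_itv/andP[h1 h2] : 0 <= a * n%:R by rewrite mulr_ge0// ltW.
  by rewrite ltW//= -natr1 lerD2r.
have jcvg : (j n)%:R / n%:R @[n --> \oo] --> a.
  apply/cvgrPdist_lt => e e0; near=> n.
  have n0 : 0 < n%:R :> R by rewrite ltr0n; near: n; exact: nbhs_infty_gt.
  have ne : e^-1 < n%:R by near: n; exact: nbhs_infty_gtr.
  have /andP[h1 h2] := jP n.
  have h3 : 1 < e * n%:R by rewrite mulrC -ltr_pdivrMr// mul1r.
  have xn : (j n)%:R / n%:R * n%:R = (j n)%:R :> R by rewrite divfK// gt_eqF.
  by rewrite ltr_norml; apply/andP; split; rewrite -(ltr_pM2r n0); lra.
have Hcvg : \forall n \near \oo, relative_entropy p ((j n)%:R / n%:R) < r - d.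
  apply: (@cvgr_lt _ _ _ _ _ (relative_entropy p a)); last first.
    by rewrite /d; move: Hr; lra.
  apply: continuous_cvg jcvg; apply: continuous_relative_entropy => //.
  by rewrite a0.
have jlt1 : \forall n \near \oo, (j n)%:R / n%:R < 1 :> R.
  exact: (@cvgr_lt _ _ _ _ _ a jcvg 1 a1).
near=> n.
have n0 : 0 < n%:R :> R by rewrite ltr0n; near: n; exact: nbhs_infty_gt.
have jn : (0 < j n < n)%N.
  rewrite /= -(ltr_nat R) -[ltRHS]mul1r -ltr_pdivrMr//.
  by near: n; exact: jlt1.
have /andP[aj _] := jP n.
apply: le_trans (binomial_tail_ge (p := p) _ (ltnW (andP jn).2) aj); last first.
  by rewrite (ltW p0) (ltW p1).
have := binomial_weight_ge p01 jn.
rewrite -ler_pdivrMl//; apply: le_trans.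
rewrite ler_pdivlMl//.
have -> : - (r * n%:R) = - (d * n%:R) + - ((r - d) * n%:R) by ring.
rewrite expRD mulrA; apply: (@le_trans _ _ (1 * expR (- ((r - d) * n%:R)))).
  rewrite ler_wpM2r ?expR_ge0//.
  by near: n; exact: near_natS_expRN_le1.
rewrite mul1r ler_expR lerN2 ler_wpM2r//.
by apply: ltW; near: n; exact: Hcvg.
Unshelve. all: by end_near. Qed.

Lemma chernoff_exponent p a r : 0 <= p -> p < a -> a <= 1 ->
  (r%:E < Lambda_star p a)%E ->
  exists2 t, 0 <= t & ln (expR t * p + (1 - p)) - t * a < - r.
Proof.
move=> p0 pa a1; have a0 := le_lt_trans p0 pa.
move: p0; rewrite le_eqVlt => /predU1P[<- _|p0].
  (* For [p = 0] the exponential moment is [1] whatever [t] is, so a large [t] reaches any rate. *)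
  exists ((`|r| + 1) / a); first by rewrite divr_ge0// ?addr_ge0// ltW.
  rewrite mulr0 add0r subr0 ln1 add0r divfK ?gt_eqF// ltrN2.
  by apply: le_lt_trans (ler_norm _) _; rewrite ltrDl.
have p1 := lt_le_trans pa a1; have q0 : 0 < 1 - p by rewrite subr_gt0.
rewrite Lambda_starE ?p0// lte_fin.
move: a1; rewrite le_eqVlt => /predU1P[->|a1].
  rewrite /relative_entropy subrr mul0r addr0 !mul1r lnV ?posrE// => rp.
  have rp' : p < expR (- r) by rewrite -ltr_ln ?posrE ?expR_gt0// expRK; lra.
  (* For [a = 1] the optimum is only approached as [t] grows. This [s] suffices because the required
     inequality amounts to [s < expR s]. *)
  pose s := (1 - p) / (expR (- r) - p).
  have s0 : 0 < s by rewrite divr_gt0// subr_gt0.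
  exists s; first exact: ltW.
  rewrite mulr1 -[X in _ - X]expRK -ln_div ?posrE ?expR_gt0//; last first.
    by rewrite addr_gt0 ?mulr_gt0 ?expR_gt0.
  rewrite -[ltRHS]expRK ltr_ln ?posrE ?divr_gt0 ?expR_gt0//; last first.
    by rewrite addr_gt0 ?mulr_gt0 ?expR_gt0.
  rewrite ltr_pdivrMr ?expR_gt0//.
  have : 1 - p < (expR (- r) - p) * expR s.
    rewrite mulrC -ltr_pdivrMr ?subr_gt0//.
    by apply: lt_le_trans (expR_ge1Dx _); rewrite ltrDr.
  by rewrite mulrBl [expR s * p]mulrC; lra.
have b0 : 0 < 1 - a by rewrite subr_gt0.
rewrite /relative_entropy => rH.
pose x := a * (1 - p) / (p * (1 - a)).
have x1 : 1 <= x by rewrite ler_pdivlMr ?mulr_gt0//; move: (ltW pa); lra.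
have x0 : 0 < x by exact: lt_le_trans x1.
(* The tilted success probability [expR t * p / (expR t * p + (1 - p))] is [a]
   for [t = ln x], which is the optimal choice. *)
exists (ln x); first by rewrite ln_ge0.
rewrite lnK ?posrE//.
have -> : x * p + (1 - p) = ((1 - a) / (1 - p))^-1.
  by rewrite /x; field; rewrite !gt_eqF.
have -> : x = (a / p) / ((1 - a) / (1 - p)).
  by rewrite /x; field; rewrite !gt_eqF.
have u0 : 0 < a / p by rewrite divr_gt0.
have v0 : 0 < (1 - a) / (1 - p) by rewrite divr_gt0.
by move: (a / p) (_ / (1 - p)) u0 v0 rH => u v u0 v0 rH;
  rewrite lnV ?ln_div ?posrE//; lra.
Qed.

(** The inequality of [chernoff_exponent] is strict, so with the same [t] it survives a small
    increase of the success probability and of the rate. *)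
Lemma binomial_tail_upper_bound p a r : 0 <= p -> p < a -> a <= 1 ->
  (r%:E < Lambda_star p a)%E ->
  exists p' c, [/\ p < p', r < c & forall n p'', 0 <= p'' -> p'' <= 1 ->
    p'' < p' -> binomial_tail n p'' a <= expR (- (c * n%:R))].
Proof.
move=> p0 pa a1 /(chernoff_exponent p0 pa a1)[t t0 ht].
have p1 := lt_le_trans pa a1; have q0 : 0 < 1 - p by rewrite subr_gt0.
have et1 : 1 <= expR t by have := expR_ge1Dx t; lra.
have mgf_gt0 x : 0 <= x -> 0 < expR t * x + (1 - x) by nra.
pose B := expR (- r + t * a).
have pB : expR t * p + (1 - p) < B.
  rewrite /B -ltr_ln ?posrE ?expR_gt0 ?mgf_gt0// expRK; move: ht; lra.
(* The exponential moment has slope [expR t - 1] in [p], so a shift by [d] uses at most half of its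
   distance to [B]. *)
pose d := (B - (expR t * p + (1 - p))) / (2 * expR t).
have d0 : 0 < d by rewrite divr_gt0 ?subr_gt0// mulr_gt0// ?expR_gt0.
have dB : 2 * (expR t * d) = B - (expR t * p + (1 - p)).
  by rewrite /d; field; rewrite gt_eqF ?expR_gt0.
pose p' := Num.min 1 (p + d).
have pp' : p < p' by rewrite /p' lt_min p1 ltrDl.
have p'1 : p' <= 1 by rewrite /p' ge_min lexx.
have p'B : expR t * p' + (1 - p') < B.
  have : p' <= p + d by rewrite /p' ge_min lexx orbT.
  by move: dB; nra.
have p'0 : 0 < expR t * p' + (1 - p').
  by rewrite mgf_gt0// ltW// (le_lt_trans p0).
exists p', (t * a - ln (expR t * p' + (1 - p'))); split => //.
  have : ln (expR t * p' + (1 - p')) < ln B.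
    by rewrite ltr_ln ?posrE// /B expR_gt0.
  by rewrite /B expRK; lra.
move=> n x x0 x1 /ltW xp'.
apply: le_trans (binomial_tail_chernoff _ _ t0 x0 xp' p'1) _.
rewrite -[X in _ * X ^+ _]lnK ?posrE// -expRM_natr -expRD ler_expR.
by rewrite le_eqVlt; apply/orP; left; apply/eqP; ring.
Qed.

End BinomialLargeDeviations.

(** * Events determined by finitely many measurable conditions *)

Section FiniteMeasurability.
Context d (T : measurableType d) (R : realType) (Q : probability T R).

(** The conditions together take finitely many values, and [A] is a union of fibers of the resulting
    map. *)
Lemma measurable_bool_family (I : finType) (b : I -> T -> bool) (A : set T) :
  (forall i, measurable [set w | b i w]) ->
  (forall w w', (forall i, b i w = b i w') -> A w -> A w') ->
  measurable A.
Proof.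
move=> mb satA; pose f w := [ffun i => b i w].
pose fiber (c : {ffun I -> bool}) := \bigcap_(i in [set: I])
  (if c i then [set w | b i w] else ~` [set w | b i w]).
have fiberP c w : fiber c w <-> f w = c.
  split=> [cw|<- i _].
    apply/ffunP => i; rewrite ffunE; have := cw i Logic.I.
    by case: (c i) => //= /negP/negbTE.
  by rewrite ffunE; case: ifPn => //= /negP.
have -> : A = \bigcup_(c in f @` A) fiber c.
  apply/seteqP; split=> [w Aw|w [_ [w' Aw' <-] /fiberP]].
    by exists (f w); [exists w|exact/fiberP].
  by move=> /ffunP ff; apply: satA Aw' => i; have := ff i; rewrite !ffunE.
apply: fin_bigcup_measurable; first exact: finite_finset.
move=> c _; apply: fin_bigcap_measurable; first exact: finite_finset.
by move=> i _; case: ifP => _ //; exact: measurableC.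
Qed.

Lemma sum_fsbig (F : finType) (B : pred F) (g : F -> \bar R) :
  (\sum_(c | B c) g c = \sum_(c \in [set c | B c]) g c)%E.
Proof.
by rewrite bigfs ?index_enum_uniq// => c; rewrite mem_index_enum.
Qed.

Lemma probability_fibers (F : finType) (f : T -> F) (B : pred F) :
  (forall c, measurable (f @^-1` [set c])) ->
  Q [set w | B (f w)] = (\sum_(c | B c) Q (f @^-1` [set c]))%E.
Proof.
move=> mf; rewrite sum_fsbig -measure_fin_bigcup//.
- congr (Q _); apply/seteqP; split=> [w Bw|w [c Bc /= ->]//].
  by exists (f w).
- exact: finite_finset.
- by move=> c c' _ _ [w [/= <- <-]].
Qed.

Lemma probability_union_bound (F : finType) (B : pred F) (E : F -> set T)
    (A : set T) :
  (forall c, measurable (E c)) -> measurable A ->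
  (forall w, A w -> exists2 c, B c & E c w) ->
  (Q A <= \sum_(c | B c) Q (E c))%E.
Proof.
move=> mE mA AE; rewrite sum_fsbig; apply: content_sub_fsum => //.
  exact: finite_finset.
Qed.

Lemma measurable_lt_fun (f g : T -> measurableTypeR R) :
  measurable_fun setT f -> measurable_fun setT g ->
  measurable [set w | (f w < g w)%R].
Proof.
move=> mf mg; have := measurable_fun_ltr mf mg measurableT
  (Y := [set true]) Logic.I.
by rewrite setTI.
Qed.

Lemma measurable_eq_fun (f g : T -> measurableTypeR R) :
  measurable_fun setT f -> measurable_fun setT g ->
  measurable [set w | f w = g w].
Proof.
move=> mf mg; apply: (@measurable_bool_family _
  (fun b w => if b then (f w < g w)%R else (g w < f w)%R)).
  by case; exact: measurable_lt_fun.
move=> w w' ww' /= e; apply/eqP; rewrite eq_le !leNgt.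
by rewrite -(ww' true) -(ww' false) e ltxx.
Qed.

Lemma le_probability_null (A B N : set T) :
  measurable A -> measurable B -> measurable N -> Q N = 0%E ->
  (forall w, ~ N w -> A w -> B w) -> (Q A <= Q B)%E.
Proof.
move=> mA mB mN N0 AB.
rewrite -(measureU0 mB mN N0); apply: le_measure; rewrite ?inE//.
  exact: measurableU.
by move=> w Aw; have [Nw|nNw] := pselect (N w); [right|left; exact: AB].
Qed.

End FiniteMeasurability.

(** * Counts and ties among independent points *)

Section IIDPoints.
Context {R : realType}.
Local Notation plane := (measurableTypeR R * measurableTypeR R)%type.
Context d (T : measurableType d) (Q : probability T R).
Variable mu : probability plane R.
Variables (n : nat) (Z : 'I_n -> {mfun T >-> plane}).
Hypothesis iidZ : iid Q mu Z.

(** Once the set [J] of points in [D] is prescribed, every point is constrained to [D] or to its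
    complement, and independence gives a Bernoulli weight. *)
Lemma probability_count (D : set plane) (a : R) : measurable D ->
  Q [set w | a * n%:R <= #|[set i | `[< D (Z i w) >]]%SET|%:R] =
  (binomial_tail n (fine (mu D)) a)%:E.
Proof.
move=> mD; pose f w := [set i | `[< D (Z i w) >]]%SET.
have fE J : f @^-1` [set J] =
    \bigcap_(i in [set` [set: 'I_n]%SET])
      (Z i @^-1` (if i \in J then D else ~` D)).
  apply/seteqP; split=> [w <- i _ /=|w h /=].
    by rewrite finset.inE; case: asboolP.
  apply/finset.setP => i; rewrite finset.inE.
  have /= := h i (finset.in_setT i).
  by case: (i \in J) => ?; apply/asboolP.
have mif (J : {set 'I_n}) i : measurable (if i \in J then D else ~` D).
  by case: ifP => // _; exact: measurableC.
have mf J : measurable (f @^-1` [set J]).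
  rewrite fE; apply: fin_bigcap_measurable; first exact: finite_finset.
  by move=> i _; exact: measurable_funPTI.
rewrite (probability_fibers Q (fun J : {set 'I_n} => a * n%:R <= #|J|%:R) mf).
rewrite /binomial_tail -sumEFin; apply: eq_bigr => J _.
rewrite fE; have [-> // Zmu] := iidZ.
have fin_D : mu D \is a fin_num by exact: fin_num_measure.
rewrite (eq_bigr (fun i =>
  (if i \in J then fine (mu D) else 1 - fine (mu D))%:E)); last first.
  move=> i _; rewrite Zmu//; case: ifP => _; first by rewrite fineK.
  by rewrite probability_setC// EFinB fineK.
rewrite prodEFin; congr EFin.
rewrite (eq_bigl xpredT); last by move=> i; rewrite finset.inE.
exact: prod_bernoulli_weight.
Qed.

Lemma measurable_unit_square : measurable (unit_square : set plane).
Proof. by apply: measurableX; exact: measurable_itv. Qed.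

Lemma uniform_prob_itv_le (a b : R) : a <= b ->
  (uniform_prob (@ltr01 R) `[a, b[%classic <= (b - a)%:E)%E.
Proof.
move=> ab; rewrite /uniform_prob.
apply: (@le_trans _ _ (\int[lebesgue_measure]_(x in `[a, b[) (cst 1 x))%E).
  apply: ge0_le_integral => //.
  - by move=> x _; rewrite lee_fin uniform_pdf_ge0.
  - apply/measurable_EFinP; apply: measurable_funTS.
    exact: measurable_uniform_pdf.
  - by move=> x _; rewrite lee_fin /uniform_pdf subr0 invr1; case: ifP.
rewrite integral_cst ?mul1e; last exact: measurable_itv.
have -> : (lebesgue_measure : measure _ R) `[a, b[%classic =
    (if (a < b)%R then (b - a)%:E else 0)%E.
  exact: (lebesgue_measure_itv (Interval (BLeft a) (BLeft b))).
by case: ifP => //; rewrite lee_fin subr_ge0.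
Qed.

(** A tie within the square puts both values in the same interval of length [1 / N]. By independence
    each interval contributes at most [1 / N ^ 2], and the sum over [N.+1] intervals is at most
    [2 / N]. *)
Lemma probability_tie (f : plane -> R) (i j : 'I_n) : i != j ->
  mu unit_square = 1%E ->
  measurable_fun setT (f : plane -> measurableTypeR R) ->
  (forall z, unit_square z -> 0 <= f z <= 1) ->
  (forall A : set (measurableTypeR R), measurable A ->
    mu (f @^-1` A) = uniform_prob (@ltr01 R) A) ->
  Q [set w | f (Z i w) = f (Z j w)] = 0.
Proof.
move=> ij musq mf f01 muf; have [indep Zmu] := iidZ.
have mfZ k : measurable_fun setT (fun w => f (Z k w) : measurableTypeR R).
  exact: measurableT_comp.
have mtie : measurable [set w | f (Z i w) = f (Z j w)].
  exact: measurable_eq_fun.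
have bound N : (0 < N)%N ->
    (Q [set w | f (Z i w) = f (Z j w)] <= (2 / N%:R)%:E)%E.
  move=> N0; have NR0 : 0 < N%:R :> R by rewrite ltr0n.
  (* The interval of index [N] is there for the value [1]; the left summand of [E] collects the null
     event of leaving the square. *)
  pose I (k : 'I_N.+1) : set R := `[k%:R / N%:R, k%:R / N%:R + N%:R^-1[%classic.
  pose E (o : 'I_1 + 'I_N.+1) := if o is inr k then
      \bigcap_(l in [set` [set i; j]%SET]) (Z l @^-1` (f @^-1` I k))
    else Z i @^-1` (~` unit_square).
  have mI k : measurable (f @^-1` I k).
    rewrite -[X in measurable X]setTI; apply: mf => //.
    exact: measurable_itv.
  have mE o : measurable (E o).
    case: o => [u|k].
      apply: measurable_funPTI; apply: measurableC.
      exact: measurable_unit_square.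
    apply: fin_bigcap_measurable; first exact: finite_finset.
    by move=> l _; exact: measurable_funPTI.
  have sub w : f (Z i w) = f (Z j w) -> exists2 o, xpredT o & E o w.
    move=> e; have [sq|nsq] := pselect (unit_square (Z i w)); last first.
      by exists (inl ord0).
    have /andP[f0 f1] := f01 _ sq.
    have /truncn_itv/andP[t1 t2] : 0 <= f (Z i w) * N%:R by rewrite mulr_ge0.
    have tN : (Num.trunc (f (Z i w) * N%:R) < N.+1)%N.
      rewrite ltnS -(ler_nat R); apply: le_trans t1 _.
      by rewrite ler_piMl.
    exists (inr (Ordinal tN)) => // l; rewrite /= !inE => lij.
    have -> : f (Z l w) = f (Z i w) by case/orP: lij => /eqP ->.
    rewrite /I/= in_itv/= ler_pdivrMr// t1/=.
    by rewrite -[X in _ + X]mul1r -mulrDl ltr_pdivlMr// natr1.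
  apply: le_trans (probability_union_bound Q mE mtie sub) _.
  rewrite big_sumType/= big_ord1 Zmu; last first.
    by apply: measurableC; exact: measurable_unit_square.
  rewrite probability_setC ?musq; last exact: measurable_unit_square.
  rewrite subee// add0e.
  apply: (@le_trans _ _ (\sum_(k < N.+1) (N%:R^-1 * N%:R^-1)%:E)%E).
    apply: lee_sum => k _; rewrite indep// big_setU1/= ?inE// big_set1.
    rewrite !Zmu// muf; last exact: measurable_itv.
    have := @uniform_prob_itv_le (k%:R / N%:R) (k%:R / N%:R + N%:R^-1).
    rewrite addrAC subrr add0r lerDl invr_ge0 ltW// => /(_ isT) h.
    by rewrite EFinM; apply: lee_pmul.
  rewrite sumEFin lee_fin sumr_const card_ord -[leLHS]mulr_natl mulrA.
  rewrite ler_pdivrMr//.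
  rewrite divfK ?gt_eqF// ler_pdivrMr// -natr1.
  by have : 1 <= N%:R :> R by [rewrite ler1n]; lra.
apply/eqP; rewrite eq_le measure_ge0 andbT.
apply/lee_addgt0Pr => e e0; rewrite add0e.
have [N0 NP] : exists N : nat, 2 / e < N%:R.
  by exists (Num.trunc (2 / e)).+1; have /truncn_itv/andP[] : 0 <= 2 / e
    by rewrite divr_ge0// ltW.
have N1 : (0 < N0)%N.
  by rewrite -(ltr0n R); apply: lt_trans NP; rewrite divr_gt0.
apply: le_trans (bound _ N1) _; rewrite lee_fin ler_pdivrMr ?ltr0n//.
by rewrite mulrC -ler_pdivrMr// ltW.
Qed.

End IIDPoints.

(** * Discretization of the square *)

Section Cells.
Context {R : realType}.
Local Notation plane := (measurableTypeR R * measurableTypeR R)%type.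
Implicit Types (z a b : R * R) (N : nat).

Definition coord (b : bool) z : R := if b then z.1 else z.2.

(* The cell of [z] records which thresholds [t / N] lie below each coordinate;
   this makes [cell] monotone and Borel without any floor function. *)
Definition cell N z : {ffun bool * 'I_N.+1 -> bool} :=
  [ffun bt : bool * 'I_N.+1 => bt.2%:R / N%:R <= coord bt.1 z].

Lemma unit_squareP z : unit_square z <-> forall i, 0 <= coord i z <= 1.
Proof.
split=> [[]|h]; first by rewrite /= !in_itv/= => ? ? [].
by split; rewrite /= in_itv/=; [exact: (h true)|exact: (h false)].
Qed.

(** Two values more than one mesh apart are separated by a threshold. Cells record the thresholds,
    so the order passes to all points of the two cells. *)
Lemma ltr_coord_cell N (i : bool) a b a' b' : (0 < N)%N -> unit_square b ->
  coord i a + N%:R^-1 < coord i b -> cell N a = cell N a' ->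
  cell N b = cell N b' -> coord i a' < coord i b'.
Proof.
move=> N0 /unit_squareP/(_ i)/andP[b0 b1] ab aa' bb'.
have NR0 : 0 < N%:R :> R by rewrite ltr0n.
have /truncn_itv/andP[t1 t2] : 0 <= coord i b * N%:R by rewrite mulr_ge0.
set t := Num.trunc _ in t1 t2.
have tN : (t < N.+1)%N.
  by rewrite ltnS -(ler_nat R); apply: le_trans t1 _; rewrite ler_piMl.
have tb : t%:R / N%:R <= coord i b by rewrite ler_pdivrMr.
have ta : coord i a < t%:R / N%:R.
  rewrite -(ltrD2r N%:R^-1) (lt_le_trans ab)//.
  by rewrite -[X in _ + X]mul1r -mulrDl natr1 ler_pdivlMr// ltW.
have /ffunP/(_ (i, Ordinal tN)) := aa'; have /ffunP/(_ (i, Ordinal tN)) := bb'.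
rewrite !ffunE/= tb (lt_geF ta) => /esym tb' /esym/negbT; rewrite -ltNge => ta'.
exact: lt_le_trans tb'.
Qed.

Lemma cell_dist N (i : bool) a b :
  (0 < N)%N -> unit_square a -> unit_square b ->
  cell N a = cell N b -> `|coord i a - coord i b| <= N%:R^-1.
Proof.
move=> N0 sqa sqb ab; have N0' : 0 <= N%:R^-1 :> R by rewrite invr_ge0.
rewrite ler_norml; apply/andP; split; rewrite leNgt; apply/negP => h.
- have h' : coord i a + N%:R^-1 < coord i b by lra.
  by have := ltr_coord_cell N0 sqb h' ab (esym ab); lra.
- have h' : coord i b + N%:R^-1 < coord i a by lra.
  by have := ltr_coord_cell N0 sqa h' (esym ab) ab; lra.
Qed.

Lemma measurable_coord (i : bool) :
  measurable_fun setT (coord i : plane -> measurableTypeR R).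
Proof. by case: i; [exact: measurable_fst|exact: measurable_snd]. Qed.

Lemma measurable_cell N (S : {set {ffun bool * 'I_N.+1 -> bool}}) :
  measurable [set z : plane | cell N z \in S].
Proof.
apply: (@measurable_bool_family _ _ _
  (fun (bt : bool * 'I_N.+1) (z : plane) => cell N z bt)); last first.
  by move=> z z' zz' /=; have -> : cell N z = cell N z' by exact/ffunP.
move=> [i t].
have -> : [set z : plane | cell N z (i, t)] =
    coord i @^-1` `[t%:R / N%:R, +oo[%classic.
  by apply/seteqP; split=> z /=; rewrite ffunE/= in_itv/= andbT.
rewrite -[X in measurable X]setTI.
by apply: measurable_coord => //; exact: measurable_itv.
Qed.

Lemma closure_coordP (A : set (R * R)) z :
  (forall e, 0 < e -> exists2 a, A a &
    forall i, `|coord i a - coord i z| < e) <-> closure A z.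
Proof.
split=> [h B /nbhs_ballP[e/= e0 eB]|cA e e0].
  have [a Aa az] := h e e0; exists a; split => //; apply: eB.
  by split; rewrite /ball/= distrC; [exact: (az true)|exact: (az false)].
have [a [Aa [a1 a2]]] := cA _ (nbhsx_ballx z e e0).
by exists a => // -[] /=; rewrite distrC.
Qed.

Lemma closed_unit_square : closed (unit_square : set (R * R)).
Proof.
move=> z /closure_coordP zc.
have zi i : 0 <= coord i z <= 1.
  by apply/andP; split; apply/ler_addgt0Pr => e /zc[a /unit_squareP/(_ i)
    /andP[a0 a1] /(_ i)]; rewrite ltr_norml => /andP[e1 e2]; lra.
exact/unit_squareP.
Qed.

(** A closed subset of the square is the intersection, over all meshes, of the unions of the cells
    that it meets. This relates the topology to the product sigma-algebra. *)
Lemma measurable_closed_subset (A : set (R * R)) :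
  closed A -> A `<=` unit_square -> measurable (A : set plane).
Proof.
move=> clA Asq.
pose S N := [set c : {ffun bool * 'I_N.+2 -> bool} |
  `[< exists2 a, A a & cell N.+1 a = c >]]%SET.
have -> : A = \bigcap_N ([set z | cell N.+1 z \in S N] `&` unit_square).
  apply/seteqP; split=> [a Aa N _|z zS].
    split; last exact: Asq.
    by rewrite /= inE; apply/asboolP; exists a.
  apply: clA; apply/closure_coordP => e e0.
  have [N Ne] : exists N, N.+1%:R^-1 < e.
    exists (Num.trunc e^-1); rewrite invf_plt ?posrE//.
    by have /truncn_itv/andP[] : 0 <= e^-1 by rewrite invr_ge0 ltW.
  have [] := zS N Logic.I; rewrite /= inE => /asboolP[a Aa az] sqz.
  exists a => // i; apply: le_lt_trans Ne; apply: cell_dist => //; exact: Asq.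
apply: bigcapT_measurable => N; apply: measurableI.
  exact: measurable_cell.
exact: measurable_unit_square.
Qed.

End Cells.

(** * The supremum [LIS_tilde] as a real number *)

Section LisTilde.
Context {R : realType}.
Local Notation plane := (measurableTypeR R * measurableTypeR R)%type.
Variables (mu : probability plane R) (k : nat).

Let admissible := [set A : set (R * R) |
  [/\ closed A, A `<=` unit_square & k_nondecreasing k A]].

Lemma k_nondecreasing0 : @k_nondecreasing R k set0.
Proof.
exists (fun=> set0); split=> [j a b []|].
by apply/seteqP; split=> z // [].
Qed.

Lemma LIS_tilde_EFin :
  ereal_sup [set mu A | A in admissible] = (LIS_tilde k mu)%:E.
Proof.
rewrite /LIS_tilde fineK// fin_numE; apply/andP; split.
  suff : (0 <= ereal_sup [set mu A | A in admissible])%E by case: ereal_sup.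
  rewrite -(measure0 mu); apply: ereal_sup_ubound; exists set0 => //; split.
  - exact: closed0.
  - exact: sub0set.
  - exact: k_nondecreasing0.
suff : (ereal_sup [set mu A | A in admissible] <= 1)%E by case: ereal_sup.
apply: ge_ereal_sup => _ [A [clA Asq _] <-]; apply: probability_le1.
exact: measurable_closed_subset.
Qed.

Lemma LIS_tilde_ub A : closed A -> A `<=` unit_square -> k_nondecreasing k A ->
  (mu A <= (LIS_tilde k mu)%:E)%E.
Proof.
move=> clA Asq ndA; rewrite -LIS_tilde_EFin.
by apply: ereal_sup_ubound; exists A.
Qed.

Lemma LIS_tilde_ge0 : 0 <= LIS_tilde k mu.
Proof.
rewrite -lee_fin; have := LIS_tilde_ub closed0 (@sub0set _ _) k_nondecreasing0.
by rewrite measure0.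
Qed.

Lemma LIS_tilde_approx e : e < LIS_tilde k mu -> exists A : set (R * R),
  [/\ closed A, A `<=` unit_square, k_nondecreasing k A & (e%:E < mu A)%E].
Proof.
rewrite -lte_fin -LIS_tilde_EFin => /ereal_sup_gt[_ [A [clA Asq ndA] <-] eA].
by exists A.
Qed.

End LisTilde.

(** * Passage from cell families to closed nondecreasing sets *)

Section Compactness.
Context {R : realType}.
Local Notation plane := (measurableTypeR R * measurableTypeR R)%type.
Variables (mu : probability plane R) (k : nat).

(** Only inversions exceeding [e] in both coordinates are excluded: this is what is left of
    monotonicity when points are replaced by their cells. *)
Definition approx_nondecreasing (e : R) (E : set (R * R)) :=
  forall a b, E a -> E b -> ~ (a.1 + e < b.1 /\ b.2 + e < a.2).

(** The extreme cells are unbounded, hence the intersection with the square. *)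
Definition cells_square N (S : {set {ffun bool * 'I_N.+1 -> bool}}) :
  set (R * R) := [set z | cell N z \in S] `&` unit_square.

(** Otherwise [U] would contain the complements of all fibers, and so their finite intersection,
    which is empty. *)
Lemma ultra_finType T (U : set_system T) (F : finType) (f : T -> F) :
  UltraFilter U -> exists c, U (f @^-1` [set c]).
Proof.
move=> UU; apply/not_existsP => h.
apply: (@filter_not_empty _ U).
have : U [set x | forall c, (~` (f @^-1` [set c])) x].
  apply: filter_forall => c.
  by case: (in_ultra_setVsetC (f @^-1` [set c]) UU) => // /h.
by apply: filterS => x /(_ (f x)); apply.
Qed.

(* Otherwise there are counterexamples [S m] for all meshes [1 / m.+1].  Along an
   ultrafilter [U] their traces on each fixed mesh stabilize, and so they have
   closed limits [A j], which are nondecreasing and retain the mass [beta]. *)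
Lemma mass_approx_nondecreasing beta : LIS_tilde k mu < beta ->
  exists2 N, (0 < N)%N &
    forall S : 'I_k -> {set {ffun bool * 'I_N.+1 -> bool}},
    (forall j, approx_nondecreasing N%:R^-1 (cells_square (S j))) ->
    (mu (\bigcup_j cells_square (S j)) < beta%:E)%E.
Proof.
move=> ltbeta; apply: contrapT => nex.
have {nex} ex m : exists S : 'I_k -> {set {ffun bool * 'I_m.+2 -> bool}},
    (forall j, approx_nondecreasing m.+1%:R^-1 (cells_square (S j))) /\
    (beta%:E <= mu (\bigcup_j cells_square (S j)))%E.
  apply: contrapT => nS; apply: nex; exists m.+1 => // S ndS.
  by rewrite ltNge; apply/negP => ?; apply: nS; exists S.
pose S m := sval (cid (ex m)).
have ndS m j : approx_nondecreasing m.+1%:R^-1 (cells_square (S m j)).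
  by rewrite /S; case: cid => s [].
have massS m : (beta%:E <= mu (\bigcup_j cells_square (S m j)))%E.
  by rewrite /S; case: cid => s [].
have [U [UU ooU]] := @ultraFilterLemma nat \oo _.
pose trace l m := [ffun j => [set c : {ffun bool * 'I_l.+2 -> bool} |
  `[< exists2 z, cells_square (S m j) z & cell l.+1 z = c >]]%SET].
pose s l := sval (cid (ultra_finType (trace l) UU)).
have sU l : U (trace l @^-1` [set s l]) by rewrite /s; case: cid.
pose B l j := closure (cells_square (s l j)).
have Bsq l j : B l j `<=` unit_square.
  apply: subset_trans (closed_unit_square).
  by apply: closure_subset => z [].
have mB l j : measurable (B l j : set plane).
  by apply: measurable_closed_subset => //; exact: closed_closure.
have cells_B l m j : trace l m = s l -> cells_square (S m j) `<=` B l j.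
  move=> trm z Sz; apply: subset_closure; split; last by case: Sz.
  by rewrite /= -trm /trace ffunE inE; apply/asboolP; exists z.
pose A j := \bigcap_l B l j.
have clA : closed (\bigcup_j A j).
  apply: closed_bigcup; first exact: finite_finset.
  by move=> j _; apply: closed_bigI => l _; exact: closed_closure.
have Asq : \bigcup_j A j `<=` unit_square.
  by move=> z [j _ /(_ 0%N Logic.I)/Bsq].
have order j a b : A j a -> A j b -> a.1 < b.1 -> b.2 < a.2 -> False.
  move=> Aa Ab ab1 ba2.
  (* The constant 5 adds up the displacements, below [2 * e] for each of the two points ([e] from
     the closure, [e] from the cell), and the slack of at most [e] in [ndS]. *)
  have [l hl] : exists l : nat,
      5 * l.+1%:R^-1 < Num.min (b.1 - a.1) (a.2 - b.2).
    have g0 : 0 < Num.min (b.1 - a.1) (a.2 - b.2).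
      by rewrite lt_min !subr_gt0 ab1.
    exists (Num.trunc (5 / Num.min (b.1 - a.1) (a.2 - b.2))).
    rewrite ltr_pdivrMr// mulrC -ltr_pdivrMr//.
    by have /truncn_itv/andP[] : 0 <= 5 / Num.min (b.1 - a.1) (a.2 - b.2)
      by rewrite divr_ge0// ltW.
  set e := l.+1%:R^-1 in hl.
  have e0 : 0 < e by rewrite invr_gt0.
  move: hl; rewrite lt_min => /andP[hl1 hl2].
  have [m [trm lm]] : exists m, trace l m = s l /\ (l <= m)%N.
    apply: (@filter_ex _ U); apply: filterI; first exact: sU.
    by apply: ooU; exact: nbhs_infty_ge.
  have me : m.+1%:R^-1 <= e :> R by rewrite lef_pV2 ?posrE// ler_nat.
  have near_cell z : A j z -> exists2 z', cells_square (S m j) z' &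
      forall i, `|coord i z' - coord i z| < 2 * e.
    move=> /(_ l Logic.I)/closure_coordP/(_ e e0)[y [ys ysq] yz].
    move: ys; rewrite /= -trm /trace ffunE inE => /asboolP[z' z'S z'y].
    exists z' => // i; have sqz' : unit_square z' by case: z'S.
    have := cell_dist i (ltn0Sn l) sqz' ysq z'y; rewrite -/e.
    have := yz i; rewrite !ltr_norml !ler_norml => /andP[? ?] /andP[? ?].
    by apply/andP; split; lra.
  have [a' a'S a'a] := near_cell _ Aa; have [b' b'S b'b] := near_cell _ Ab.
  apply: (ndS m j a' b') => //.
  have := a'a true; have := a'a false; have := b'b true; have := b'b false.
  rewrite /= !ltr_norml => /andP[? ?] /andP[? ?] /andP[? ?] /andP[? ?].
  by move: (_^-1) me => e' me; split; lra.
have ndA : k_nondecreasing k (\bigcup_j A j).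
  exists A; split => // j a b Aa Ab; rewrite leNgt; apply/negP => ab.
  have [ab1|ab1|ab1] := ltgtP a.1 b.1.
  - apply: (order j a b) => //; move: ab.
    by rewrite pmulr_rlt0 ?subr_gt0 ?subr_lt0.
  - apply: (order j b a) => //; move: ab.
    by rewrite nmulr_rlt0 ?subr_lt0// subr_gt0.
  - by move: ab; rewrite ab1 subrr mul0r ltxx.
have := LIS_tilde_ub mu clA Asq ndA; apply/negP; rewrite -ltNge.
rewrite (lt_le_trans (y := beta%:E)) ?lte_fin//.
(* The sets [F L] decrease to the union of the [A j], because for finitely many [j] the union
   commutes with this decreasing limit; continuity from above then applies. *)
pose F L := \bigcup_(j in [set: 'I_k]) \bigcap_(l in `I_L.+1) B l j.
have mF L : measurable (F L : set plane).
  apply: fin_bigcup_measurable; first exact: finite_finset.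
  move=> j _; apply: fin_bigcap_measurable; first exact: finite_II.
  by move=> l _; exact: mB.
have -> : \bigcup_j A j = \bigcap_L F L.
  apply/seteqP; split=> [z [j _ Az] L _|z Fz].
    by exists j => // l _; exact: Az.
  apply: contrapT => nA.
  have /choice[l lP] : forall j, exists l, ~ B l j z.
    move=> j; apply: contrapT => nB; apply: nA; exists j => // l _.
    by apply: contrapT => nBl; apply: nB; exists l.
  have [j _ Bj] := Fz (\max_j l j)%N Logic.I.
  by apply: (lP j); apply: Bj; rewrite /= ltnS; exact: leq_bigmax.
have Fcvg : mu \o F @ \oo --> mu (\bigcap_L F L).
  apply: nonincreasing_cvg_mu => //.
  - by apply: le_lt_trans (probability_le1 mu (mF 0%N)) _; exact: ltry.
  - exact: bigcapT_measurable.
  - move=> L L' LL'; apply/subsetPset => z [j _ Bz]; exists j => // l /= lL.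
    by apply: Bz; exact: leq_trans lL _.
rewrite -(cvg_lim _ Fcvg)//; apply: lime_ge.
  by apply/cvg_ex; eexists; exact: Fcvg.
apply: nearW => L /=.
(* Finitely many conditions that hold along [U] hold at a common [m], which serves all meshes up to
   [L]. *)
have [m trm] : exists m, forall l : 'I_L.+1, trace l m = s l.
  apply: (@filter_ex _ U); apply: filter_forall => l; exact: sU.
apply: le_trans (massS m) _; apply: le_measure; rewrite ?inE.
- apply: fin_bigcup_measurable; first exact: finite_finset.
  move=> j _; apply: measurableI; last exact: measurable_unit_square.
  exact: measurable_cell.
- exact: mF.
- move=> z [j _ Sz]; exists j => // l /= lL.
  exact: (cells_B _ _ _ (trm (Ordinal lL))).
Qed.

End Compactness.

(** * Dependence of the permutation on the order of the coordinates *)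

Section PermOfPoints.
Context {R : realType}.
Variable n : nat.
Implicit Types z : 'I_n -> R * R.

Lemma perm_of_points_order z z' :
  (forall (b : bool) i j, (coord b (z i) < coord b (z j)) =
                 (coord b (z' i) < coord b (z' j))) ->
  perm_of_points z = perm_of_points z'.
Proof.
move=> zz'; rewrite /perm_of_points.
have -> : rank (fst \o z) = rank (fst \o z').
  apply/funext => i; apply: eq_card => j; rewrite !inE/=.
  exact: (zz' true).
have -> // : rank (snd \o z) = rank (snd \o z').
apply/funext => i; apply: eq_card => j; rewrite !inE/=.
exact: (zz' false).
Qed.

Definition generic_points z :=
  injective (fst \o z) /\ injective (snd \o z).

End PermOfPoints.

(** * Bounds on the law of [LIS] for a fixed sample size *)

Section Sampling.
Context {R : realType}.
Local Notation plane := (measurableTypeR R * measurableTypeR R)%type.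
Context d (T : measurableType d) (Q : probability T R).
Variable mu : probability plane R.
Variables (n : nat) (Z : 'I_n -> {mfun T >-> plane}).
Hypotheses (iidZ : iid Q mu Z) (hmu : is_permuton mu).
Let z w i := Z i w.

Lemma measurable_coord_point b i :
  measurable_fun setT (fun w => coord b (Z i w) : measurableTypeR R).
Proof. by apply: measurableT_comp => //; exact: measurable_coord. Qed.

Lemma measurable_perm_of_points (S : set 'S_n) :
  measurable [set w | S (perm_of_points (z w))].
Proof.
apply: (@measurable_bool_family _ _ _ (fun (c : bool * ('I_n * 'I_n)) w =>
  coord c.1 (Z c.2.1 w) < coord c.1 (Z c.2.2 w))).
  by move=> c; apply: measurable_lt_fun; exact: measurable_coord_point.
move=> w w' ww'; rewrite /= (_ : perm_of_points _ = perm_of_points (z w'))//.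
by apply: perm_of_points_order => b i j; exact: (ww' (b, (i, j))).
Qed.

Lemma measurable_count (D : set plane) (a : R) : measurable D ->
  measurable [set w | a * n%:R <= #|[set i | `[< D (Z i w) >]]%SET|%:R].
Proof.
move=> mD; apply: (@measurable_bool_family _ _ _ (fun i w => `[< D (Z i w) >])).
  move=> i; rewrite (_ : [set w | _] = Z i @^-1` D).
    exact: measurable_funPTI.
  by apply/seteqP; split=> w /asboolP.
move=> w w' ww' /=.
rewrite (_ : [set i | `[< D (Z i w) >]]%SET =
  [set i | `[< D (Z i w') >]]%SET)//.
by apply/finset.setP => i; rewrite !inE ww'.
Qed.

Lemma ae_generic_points : exists N : set T,
  [/\ measurable N, Q N = 0%E & forall w, ~ N w -> generic_points (z w)].
Proof.
have [musq mu1 mu2] := hmu.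
pose tie (c : bool * ('I_n * 'I_n)) :=
  [set w | coord c.1 (Z c.2.1 w) = coord c.1 (Z c.2.2 w)].
have mtie c : measurable (tie c).
  by apply: measurable_eq_fun; exact: measurable_coord_point.
have tie0 c : c.2.1 != c.2.2 -> Q (tie c) = 0%E.
  move=> ij; apply: (probability_tie iidZ ij musq (measurable_coord c.1)).
  - by move=> x /unit_squareP.
  - by case: c.1; [exact: mu1|exact: mu2].
pose N := \bigcup_(c in [set c : bool * ('I_n * 'I_n) | c.2.1 != c.2.2]) tie c.
have mN : measurable N by apply: fin_bigcup_measurable; [exact: finite_finset|].
exists N; split => //.
  apply/eqP; rewrite eq_le measure_ge0 andbT.
  apply: le_trans (@probability_union_bound _ _ _ Q _
    (fun c : bool * ('I_n * 'I_n) => c.2.1 != c.2.2) tie _ mtie mN _) _.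
    by move=> w [c cij cw]; exists c.
  by rewrite big1// => c; exact: tie0.
move=> w nN; split=> i j e; apply/eqP/negPn/negP => ij; apply: nN.
  by exists (true, (i, j)).
by exists (false, (i, j)).
Qed.

(** The sample points in [A] split among the pieces [B j]; without ties, points of a nondecreasing
    set are increasing. *)
Lemma LIS_lower_bound k a (A : set (R * R)) : closed A -> A `<=` unit_square ->
  k_nondecreasing k A ->
  ((binomial_tail n (fine (mu A)) a)%:E <=
   Q [set w | (a * n%:R <= (LIS k (perm_of_points (z w)))%:R)%R])%E.
Proof.
move=> clA Asq [B [ndB AB]].
have mA := measurable_closed_subset clA Asq.
have [N [mN N0 NP]] := ae_generic_points.
rewrite -(probability_count iidZ a mA).
apply: (le_probability_null _ _ mN N0).
- exact: measurable_count.
- exact: (measurable_perm_of_points [set s | a * n%:R <= (LIS k s)%:R]).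
move=> w /NP[inj1 inj2] /= /le_trans; apply; rewrite ler_nat.
pose G j := [set i | `[< B j (Z i w) >]]%SET.
rewrite (_ : finset _ = (\bigcup_j G j)%SET).
  apply: LIS_ge_points => // j i i'; rewrite !finset.inE.
  move=> /asboolP Bi /asboolP Bi' lt1.
  have := ndB j _ _ Bi Bi'; rewrite pmulr_rge0 ?subr_gt0// subr_ge0.
  rewrite le_eqVlt => /predU1P[/inj2 ii'|//].
  by move: lt1; rewrite ii' ltxx.
apply/finset.setP => i; rewrite inE; apply/asboolP/bigcupP.
  by rewrite AB => -[j _ Bj]; exists j => //; rewrite inE; exact/asboolP.
by move=> [j _]; rewrite inE AB => /asboolP Bj; exists j.
Qed.

(** The sample points of an optimal family lie in the cells that they occupy, so a large [LIS]
    forces a large count in some valid family of cells. The number of families involves [k] and [M]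
    but not [n]. *)
Lemma LIS_upper_bound k a M e : (0 < M)%N -> 0 <= e ->
  (forall p, 0 <= p -> p <= 1 ->
    (forall S : 'I_k -> {set {ffun bool * 'I_M.+1 -> bool}},
      (forall j, @approx_nondecreasing R M%:R^-1 (cells_square (S j))) ->
      mu (\bigcup_j cells_square (S j)) = p%:E ->
      binomial_tail n p a <= e)) ->
  (Q [set w | (a * n%:R <= (LIS k (perm_of_points (z w)))%:R)%R] <=
   (#|{ffun 'I_k -> {set {ffun bool * 'I_M.+1 -> bool}}}|%:R * e)%:E)%E.
Proof.
move=> M0 e0 tail_le; have [musq _ _] := hmu.
have [N [mN N0 NP]] := ae_generic_points.
pose cT := {ffun bool * 'I_M.+1 -> bool}.
pose FT := {ffun 'I_k -> {set cT}}.
pose valid (S : FT) :=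
  `[< forall j, @approx_nondecreasing R M%:R^-1 (cells_square (S j)) >].
pose D (S : FT) : set plane := [set x | cell M x \in (\bigcup_j S j)%SET].
have mD S : measurable (D S) by exact: measurable_cell.
have DE (S : FT) : mu (\bigcup_j cells_square (S j)) = mu (D S).
  rewrite (_ : \bigcup_j _ = D S `&` unit_square); last first.
    apply/seteqP; split=> [x [j _ [xS sqx]]|x [/= /bigcupP[j _ xS] sqx]].
      by split => //=; apply/bigcupP; exists j.
    by exists j.
  have := measurable_unit_square (R := R) => msq.
  have sqC : mu (~` unit_square) = 0%E by rewrite probability_setC// musq subee.
  apply/eqP; rewrite eq_le; apply/andP; split.
    by apply: le_measure; rewrite ?inE//; exact: measurableI.
  apply: (le_probability_null _ _ (measurableC msq) sqC) => //.
    exact: measurableI.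
  by move=> x /contrapT sqx Dx.
pose E (S : FT) :=
  [set w | a * n%:R <= #|[set i | `[< D S (Z i w) >]]%SET|%:R].
have mE S : measurable (E S) by exact: measurable_count.
have mU : measurable (\bigcup_(S in [set S | valid S]) E S).
  by apply: fin_bigcup_measurable => //; exact: finite_finset.
apply: (@le_trans _ _ (Q (\bigcup_(S in [set S | valid S]) E S))).
  apply: (le_probability_null _ mU mN N0).
    exact: (measurable_perm_of_points [set s | a * n%:R <= (LIS k s)%:R]).
  move=> w /NP[inj1 inj2] /=.
  have [G incG ->] := LIS_points inj1 inj2 k => aG.
  pose S : FT := [ffun j => [set cell M (Z i w) | i in G j]%SET].
  exists S; last first.
    apply: le_trans aG _; rewrite ler_nat; apply: subset_leq_card.
    apply/fintype.subsetP => i /bigcupP[j _ iG]; rewrite inE; apply/asboolP.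
    rewrite /D/=; apply/bigcupP; exists j => //.
    by rewrite ffunE; exact: imset_f.
  (* An inversion larger than the mesh would pass, by [ltr_coord_cell], to two sample points of
     [G j]. *)
  apply/asboolP => j x y [/= xS sqx] [/= yS sqy] [lt1 lt2].
  move: xS yS; rewrite ffunE => /imsetP[i iG xi] /imsetP[i' i'G yi'].
  have /(incG j _ _ iG i'G) := ltr_coord_cell (i := true) M0 sqy lt1 xi yi'.
  have := ltr_coord_cell (i := false) M0 sqx lt2 yi' xi.
  by rewrite /= => /lt_trans h /h; rewrite ltxx.
apply: le_trans (@probability_union_bound _ _ _ Q _ valid E _ mE mU _) _.
  by move=> w [S vS ES]; exists S.
have mu01 S : 0 <= fine (mu (D S)) <= 1.
  rewrite -!lee_fin fineK ?fin_num_measure// measure_ge0/=.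
  exact: probability_le1.
apply: (@le_trans _ _ (\sum_(S | valid S) e%:E)%E).
  apply: lee_sum => S /asboolP vS.
  rewrite (probability_count iidZ a (mD S)) lee_fin.
  have /andP[D0 D1] := mu01 S.
  apply: (tail_le _ D0 D1 S) => //.
  by rewrite DE fineK// fin_num_measure.
rewrite sumEFin lee_fin sumr_const -[leLHS]mulr_natl.
by rewrite ler_wpM2r// ler_nat max_card.
Qed.

End Sampling.

(** * Exponential rates and the limit *)

Section Rates.
Context {R : realType}.
Local Notation plane := (measurableTypeR R * measurableTypeR R)%type.

(** Testing against real numbers covers infinite limits too: the condition on one side is then
    vacuous. *)
Lemma ereal_cvg_squeeze (u : nat -> \bar R) (l : \bar R) :
  (forall r : R, (l < r%:E)%E -> \forall n \near \oo, (u n <= r%:E)%E) ->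
  (forall r : R, (r%:E < l)%E -> \forall n \near \oo, (r%:E <= u n)%E) ->
  u n @[n --> \oo] --> l.
Proof.
move=> uU uL; case: l uU uL => [l||] uU uL.
- have bnd e : 0 < e ->
      \forall n \near \oo, ((l - e)%:E <= u n <= (l + e)%:E)%E.
    move=> e0; near=> n; apply/andP; split; near: n.
      by apply: uL; rewrite lte_fin ltrBlDr ltrDl.
    by apply: uU; rewrite lte_fin ltrDl.
  apply/fine_cvgP; split.
    apply: filterS (bnd 1 ltr01) => n /andP[].
    by rewrite fin_numE; case: (u n).
  apply/cvgrPdist_le => e e0; apply: filterS (bnd e e0) => n /=.
  case: (u n) => [x||] //=; last by move=> /andP[].
  by rewrite !lee_fin distrC ler_distl.
- by apply/cvgeyPge => A; apply: uL; exact: ltry.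
- by apply/cvgeNyPle => A; apply: uU; exact: ltNyr.
Unshelve. all: by end_near. Qed.

Lemma lne_rate_le (p : \bar R) n r : (0 < n)%N -> (0 <= p)%E ->
  (p <= (expR (- (r * n%:R)))%:E)%E -> ((n%:R^-1)%:E * lne p <= (- r)%:E)%E.
Proof.
move=> n0; have nR0 : 0 < n%:R :> R by rewrite ltr0n.
case: p => [p||] //= _; rewrite lee_fin => pe; case: ifPn => [_|].
  by rewrite gt0_muleNy ?leNye// lte_fin invr_gt0.
rewrite -ltNge => p0; rewrite -EFinM lee_fin ler_pdivrMl//.
have : ln p <= - (r * n%:R) by rewrite -[leRHS]expRK ler_ln ?posrE ?expR_gt0.
by rewrite mulrN mulrC.
Qed.

Lemma lne_rate_ge (p : \bar R) n r : (0 < n)%N -> (p <= 1)%E ->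
  ((expR (- (r * n%:R)))%:E <= p)%E -> ((- r)%:E <= (n%:R^-1)%:E * lne p)%E.
Proof.
move=> n0; have nR0 : 0 < n%:R :> R by rewrite ltr0n.
case: p => [p||] //= _; rewrite lee_fin => pe.
have p0 : 0 < p := lt_le_trans (expR_gt0 _) pe.
rewrite (lt_geF p0) -EFinM lee_fin ler_pdivlMl//.
have : - (r * n%:R) <= ln p by rewrite -[leLHS]expRK ler_ln ?posrE ?expR_gt0.
by rewrite mulrN mulrC.
Qed.

Variables (mu : probability plane R) (k : nat) (alpha : R).
Hypotheses (hmu : is_permuton mu).
Hypotheses (halpha : LIS_tilde k mu < alpha) (halpha1 : alpha <= 1).
Context (d : nat -> measure_display) (Omega : forall n, measurableType (d n))
  (P : forall n, probability (Omega n) R) (sigma : forall n, Omega n -> 'S_n).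
Hypothesis hsigma : forall n, (0 < n)%N -> has_law_Sample mu (P n) (@sigma n).

Let large n := P n [set w | (alpha * n%:R <= (LIS k (@sigma n w))%:R)%R].

(** Since ['S_n] is finite, equality of the laws on single permutations is enough to transfer the
    event to the space carrying the points. *)
Lemma sample_LIS n : (0 < n)%N -> exists d' (T : measurableType d')
    (Q : probability T R) (Z : 'I_n -> {mfun T >-> plane}), iid Q mu Z /\
  large n = Q [set w |
    (alpha * n%:R <= (LIS k (perm_of_points (fun i => Z i w)))%:R)%R].
Proof.
move=> /hsigma[msigma [d' [T [Q [Z [iidZ law]]]]]].
exists d', T, Q, Z; split => //; rewrite /large.
rewrite (probability_fibers _ (fun s => alpha * n%:R <= (LIS k s)%:R) msigma).
rewrite (probability_fibers _ (f := fun w => perm_of_points (fun i => Z i w))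
  (fun s => alpha * n%:R <= (LIS k s)%:R)).
  by apply: eq_bigr => s _; exact: law.
by move=> s; exact: (measurable_perm_of_points Z [set s]).
Qed.

Lemma large_upper_bound r : (r%:E < Lambda_star (LIS_tilde k mu) alpha)%E ->
  \forall n \near \oo, (large n <= (expR (- (r * n%:R)))%:E)%E.
Proof.
move=> /(binomial_tail_upper_bound (LIS_tilde_ge0 mu k) halpha halpha1).
move=> [p' [c [pp' rc tail_le]]].
have [M M0 massM] := mass_approx_nondecreasing pp'.
near=> n.
have n0 : (0 < n)%N by near: n; exact: nbhs_infty_gt.
have [d' [T [Q [Z [iidZ ->]]]]] := sample_LIS n0.
apply: le_trans (LIS_upper_bound iidZ hmu M0 (expR_ge0 (- (c * n%:R))) _) _.
  move=> p p0 p1 S /massM mSp' muS; apply: tail_le => //.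
  by rewrite -lte_fin -muS.
rewrite lee_fin.
have -> : - (c * n%:R) = - ((c - r) * n%:R) + - (r * n%:R) by ring.
rewrite expRD mulrA ler_piMl ?expR_ge0//.
by near: n; apply: near_mul_expRN_le1; rewrite subr_gt0.
Unshelve. all: by end_near. Qed.

Lemma large_lower_bound r : (Lambda_star (LIS_tilde k mu) alpha < r%:E)%E ->
  \forall n \near \oo, ((expR (- (r * n%:R)))%:E <= large n)%E.
Proof.
have a0 : 0 < alpha := le_lt_trans (LIS_tilde_ge0 mu k) halpha.
have p1 : LIS_tilde k mu < 1 := lt_le_trans halpha halpha1.
have [p0|p0] := ltP 0 (LIS_tilde k mu); last first.
  (* The rate is then infinite and no real [r] lies above it. *)
  have -> : LIS_tilde k mu = 0 by apply/eqP; rewrite eq_le p0 LIS_tilde_ge0.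
  by rewrite Lambda_star0.
rewrite Lambda_starE ?p0// lte_fin => Hr.
have : \forall x \near LIS_tilde k mu, relative_entropy x alpha < r.
  apply: (cvgr_lt _ (continuous_relative_entropyl _ _)) Hr.
    by rewrite p0.
  by rewrite a0.
move=> /nbhs_ballP[e /= e0 eH].
(* The maximum with [0] makes [mu A] positive, as [binomial_tail_lower_bound] requires. *)
pose x0 := Num.max 0 (LIS_tilde k mu - e).
have [A [clA Asq ndA x0A]] : exists A : set (R * R),
    [/\ closed A, A `<=` unit_square, k_nondecreasing k A & (x0%:E < mu A)%E].
  by apply: LIS_tilde_approx; rewrite gt_max p0 ltrBlDr ltrDl.
have mA := measurable_closed_subset clA Asq.
have muAE : mu A = (fine (mu A))%:E by rewrite fineK ?fin_num_measure.
have Ap : fine (mu A) <= LIS_tilde k mu.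
  by rewrite -lee_fin -muAE; exact: LIS_tilde_ub.
move: x0A; rewrite muAE lte_fin gt_max => /andP[A0 Ae].
have HA : relative_entropy (fine (mu A)) alpha < r.
  by apply: eH; rewrite /ball/= ger0_norm ?subr_ge0//; lra.
have A1 : fine (mu A) < 1 := le_lt_trans Ap p1.
have tailA : \forall n \near \oo,
    expR (- (r * n%:R)) <= binomial_tail n (fine (mu A)) alpha.
  by apply: binomial_tail_lower_bound; rewrite ?A0 ?a0.
near=> n.
have n0 : (0 < n)%N by near: n; exact: nbhs_infty_gt.
have [d' [T [Q [Z [iidZ ->]]]]] := sample_LIS n0.
apply: le_trans (LIS_lower_bound iidZ hmu alpha clA Asq ndA).
by rewrite lee_fin; near: n.
Unshelve. all: by end_near. Qed.

End Rates.

Theorem theorem2p4 (R : realType)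
    (mu : probability (measurableTypeR R * measurableTypeR R)%type R)
    (hmu : is_permuton mu) (k : nat) (hk : (0 < k)%N)
    (d : nat -> measure_display) (Omega : forall n, measurableType (d n))
    (P : forall n, probability (Omega n) R)
    (sigma : forall n, Omega n -> 'S_n)
    (hsigma : forall n, (0 < n)%N -> has_law_Sample mu (P n) (sigma n))
    (alpha : R) (halpha : LIS_tilde k mu < alpha) (halpha1 : alpha <= 1) :
  ((n%:R^-1)%:E *
     lne (P n [set w | (alpha * n%:R <= (LIS k (sigma n w))%:R)%R]))%E
    @[n --> \oo] --> (- Lambda_star (LIS_tilde k mu) alpha)%E.
Proof.
have mlarge n : (0 < n)%N ->
    measurable [set w | (alpha * n%:R <= (LIS k (sigma n w))%:R)%R].
  move=> /hsigma[msigma _].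
  rewrite (_ : [set w | _] =
    \bigcup_(s in [set s | alpha * n%:R <= (LIS k s)%:R])
      (sigma n @^-1` [set s])).
    by apply: fin_bigcup_measurable => //; exact: finite_finset.
  by apply/seteqP; split=> [w sw|w [s sL /= ->]//]; exists (sigma n w).
apply: ereal_cvg_squeeze => r.
  rewrite lteNl -EFinN => /(large_upper_bound hmu halpha halpha1 hsigma) up.
  near=> n; rewrite -[r]opprK; apply: lne_rate_le.
  - by near: n; exact: nbhs_infty_gt.
  - exact: measure_ge0.
  - by near: n; exact: up.
rewrite lteNr -EFinN => /(large_lower_bound hmu halpha halpha1 hsigma) lo.
near=> n; rewrite -[r]opprK.
have n0 : (0 < n)%N by near: n; exact: nbhs_infty_gt.
apply: lne_rate_ge => //; first by apply: probability_le1; exact: mlarge.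
by near: n; exact: lo.
Unshelve. all: by end_near. Qed.
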